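(* Let $n\ge4$ and let $\mathcal M(\mathscr P_{i,0})$, $1\le i\le n-1$, be the collection of monomials, counted with multiplicity, associated to the paths in $\mathscr P_{i,0}$ (as defined in the context). (1) For $1\le i<n-1$, $$|\mathcal M(\mathscr P_{i,0})|=\binom{2n-2}{i}+2\sum_{j=0}^{i}\sum_{l=0}^{i-j-1}\binom{n-1}{j}\binom{n-1}{l}.$$ (2) For $i=n-1$, $$|\mathcal M(\mathscr P_{n-1,0})|=2^{n-1}.$$ Here a sum $\sum_{l=0}^{r}$ with $r<0$ is $0$.
   Context: **Paths.** Put $N=2n-2$. For $k\in\mathbb Z$ (no parity restriction is imposed): - $\mathscr P_{n-1,k}$ is the set of sequences $((0,y_0),(1,y_1),\dots,(n-1,y_{n-1}))$ of points with $y_0=n-1+k$ and $y_{r+1}-y_r\in\{1,-1\}$ for $0\le r\le n-2$. - $\widehat{\mathscr P}_{n-1,k}$ is the set of sequences $((N,y_0),(N-1,y_1),\dots,(n-1,y_{n-1}))$ with the same conditions on $y_0,\dots,y_{n-1}$. - For $1\le i\le n-2$, $\mathscr P_{i,k}$ is the set of sequences $(a_0,\dots,a_{n-1},\overline a_{n-1},\dots,\overline a_0)$ with $(a_0,\dots,a_{n-1})\in\mathscr P_{n-1,k-(n-i-1)}$, with $(\overline a_0,\dots,\overline a_{n-1})$ (listed from horizontal coordinate $N$ to $n-1$) in $\widehat{\mathscr P}_{n-1,k+(n-i-1)}$, and with $a_{n-1}-\overline a_{n-1}=(0,y)$, $y\ge0$. Such a path is written $((0,y_0),\dots,(n-1,y_{n-1}),(n-1,y'_{n-1}),(n,y_n),\dots,(N,y_N))$;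 so $y_{n-1}\ge y'_{n-1}$. **Corners away from $n-1$.** For a path $p$ and a horizontal coordinate $r\ne n-1$ that is not an endpoint ($1\le r\le n-2$ if $p\in\mathscr P_{n-1,k}$; $r\in\{1,\dots,N-1\}\setminus\{n-1\}$ if $p\in\mathscr P_{i,k}$, $i<n-1$), $(r,y_r)\in C_p^+$ if both neighbouring points of $p$ have second coordinate $y_r+1$, and $(r,y_r)\in C_p^-$ if both have second coordinate $y_r-1$. (For $r=n-2$ the right neighbour is $(n-1,y_{n-1})$; for $r=n$ the left neighbour is $(n-1,y'_{n-1})$.) **Monomials for $p\in\mathscr P_{n-1,k}$** (in formal variables $Y_{j,\ell}^{\pm1}$, $1\le j\le n$, $\ell\in\mathbb Z$). $$m(p)=W\prod_{(j,\ell)\in C_p^+,\,j\ne n-1}Y_{j,\ell}\prod_{(j,\ell)\in C_p^-,\,j\ne n-1}Y_{j,\ell}^{-1},$$ where, with $y=y_{n-1}$: if $y+1=y_{n-2}$, then $W=Y_{n-1,y}$ when $y-k\equiv0\pmod4$ and $W=Y_{n,y}$ when $y-k\equiv2\pmod 4$; if $y-1=y_{n-2}$, then $W=Y_{n,y}^{-1}$ when $y-k\equiv0\pmod4$ and $W=Y_{n-1,y}^{-1}$ when $y-k\equiv2\pmod4$. **Monomials/binomials for $p\in\mathscr P_{i,k}$, $1\le i\le n-2$.** Put $\overline j=j$ for $j\le n-2$ and $\overline j=N-j$ for $j\ge n$. Then $$m(p)=Z\prod_{(j,\ell)\in C_p^+,\,j\ne n-1}Y_{\overline j,\ell}\prod_{(j,\ell)\in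 C_p^-,\,j\ne n-1}Y^{-1}_{\overline j,\ell}.$$ Let $\ell_2=y_{n-1}$ and $\ell_1=y'_{n-1}$ (so $\ell_1\le\ell_2$ and $\ell_2-\ell_1$ is even). If $\ell_1<\ell_2$, $Z$ is: 1. if $y_{n-2}=\ell_2-1$ and $y_n=\ell_1+1$: $Y_{n-1,\ell_1}Y_{n,\ell_2}^{-1}+Y_{n,\ell_1}Y_{n-1,\ell_2}^{-1}$ if $\ell_2-\ell_1\equiv2\pmod4$; $Y_{n-1,\ell_1}Y_{n-1,\ell_2}^{-1}+Y_{n,\ell_1}Y_{n,\ell_2}^{-1}$ if $\equiv0\pmod 4$; 2. if $y_{n-2}=\ell_2-1$ and $y_n=\ell_1-1$: $Y_{n-1,\ell_1}^{-1}Y_{n,\ell_2}^{-1}+Y_{n,\ell_1}^{-1}Y_{n-1,\ell_2}^{-1}$ if $\ell_2-\ell_1\equiv0\pmod 4$; $Y_{n-1,\ell_1}^{-1}Y_{n-1,\ell_2}^{-1}+Y_{n,\ell_1}^{-1}Y_{n,\ell_2}^{-1}$ if $\equiv2\pmod 4$; 3. if $y_{n-2}=\ell_2+1$ and $y_n=\ell_1+1$: $Y_{n-1,\ell_1}Y_{n,\ell_2}+Y_{n,\ell_1}Y_{n-1,\ell_2}$ if $\ell_2-\ell_1\equiv0\pmod 4$; $Y_{n-1,\ell_1}Y_{n-1,\ell_2}+Y_{n,\ell_1}Y_{n,\ell_2}$ if $\equiv2\pmod 4$; 4. if $y_{n-2}=\ell_2+1$ and $y_n=\ell_1-1$: $Y_{n-1,\ell_1}^{-1}Y_{n,\ell_2}+Y_{n,\ell_1}^{-1}Y_{n-1,\ell_2}$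 if $\ell_2-\ell_1\equiv2\pmod 4$; $Y_{n-1,\ell_1}^{-1}Y_{n-1,\ell_2}+Y_{n,\ell_1}^{-1}Y_{n,\ell_2}$ if $\equiv0\pmod 4$. If $\ell_1=\ell_2=:\ell$: $Z=Y_{n-1,\ell}Y_{n,\ell}$ if $y_{n-2}=y_n=\ell+1$; $Z=Y_{n-1,\ell}^{-1}Y_{n,\ell}^{-1}$ if $y_{n-2}=y_n=\ell-1$; and $Z=1$ if $\{y_{n-2},y_n\}=\{\ell-1,\ell+1\}$. **The collection $\mathcal M(\mathscr P_{i,0})$.** Each $m(p)$ is a single monomial or a sum of two monomials. $\mathcal M(\mathscr P_{i,0})$ is the multiset of all monomials occurring in the $m(p)$, $p\in\mathscr P_{i,0}$ (one or two for each path $p$), counted with multiplicity, and $|\cdot|$ is the cardinality with multiplicity. *)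

(* Defs.v *)
From HB Require Import structures.
From mathcomp Require Import all_boot all_order all_algebra.
From mathcomp Require Import finmap multiset.
From mathcomp Require Import boolp classical_sets cardinality.
From mathcomp Require Import freeg.

Set Implicit Arguments.
Unset Strict Implicit.
Unset Printing Implicit Defensive.

Import Order.TTheory GRing.Theory Num.Theory.
Local Open Scope ring_scope.
Local Open Scope mset_scope.


(* (horizontal coordinate, height) *)
Definition point : Type := (nat * int)%type.

(* The s-th point of the list p, counted from 0. *)
Definition pt (p : seq point) (s : nat) : point := nth (0%N, 0) p s.

(* n points with horizontal coordinates h 0, ..., h (n-1), whose heights start
   at n-1+k and change by +1 or -1 at each step. *)
Definition walk (n : nat) (k : int) (h : nat -> nat) (p : seq point) : Prop :=
  [/\ size p = n,
      forall r, (r < n)%N -> (pt p r).1 = h r,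
      (pt p 0).2 = n%:Z - 1 + k &
      forall r, (r < n - 1)%N ->
        (pt p r.+1).2 - (pt p r).2 = 1 \/ (pt p r.+1).2 - (pt p r).2 = -1].

Definition spin_paths (n : nat) (k : int) : set (seq point) :=
  [set p | walk n k (fun r => r) p]%classic.

Definition spin_paths_hat (n : nat) (k : int) : set (seq point) :=
  [set p | walk n k (fun r => (2 * n - 2 - r)%N) p]%classic.

(* These lists have 2n entries: both a_{n-1} and \bar a_{n-1}, which have
   horizontal coordinate n-1, are present, even when they coincide. *)
Definition vec_paths (n i : nat) (k : int) : set (seq point) :=
  [set p | exists a b : seq point,
     [/\ spin_paths n (k - (n%:Z - i%:Z - 1)) a,
         spin_paths_hat n (k + (n%:Z - i%:Z - 1)) b,
         (pt a n.-1).1 = (pt b n.-1).1,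
         (pt b n.-1).2 <= (pt a n.-1).2 &
         p = a ++ rev b]]%classic.

(* Meaningful for 1 <= i <= n-1. *)
Definition paths (n i : nat) (k : int) : set (seq point) :=
  if i == n.-1 then spin_paths n k else vec_paths n i k.

(* Points of p that are not endpoints, have horizontal coordinate <> n-1, and
   whose two neighbours in p have height exceeding theirs by e.  Neighbouring
   points of p are consecutive in the list; in particular, in a 2n-entry list
   the right neighbour of (n-2, y_{n-2}) is (n-1, y_{n-1}) and the left
   neighbour of (n, y_n) is (n-1, y'_{n-1}). *)
Definition corners (e : int) (n : nat) (p : seq point) : seq point :=
  [seq pt p s | s <- iota 1 (size p - 2) &
     [&& (pt p s).1 != n.-1,
         (pt p s.-1).2 == (pt p s).2 + e &
         (pt p s.+1).2 == (pt p s).2 + e]].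

Definition Cplus : nat -> seq point -> seq point := corners 1.
Definition Cminus : nat -> seq point -> seq point := corners (-1).


(* Laurent monomials in the Y_{j,l}: the free abelian group on the pairs
   (j, l), in additive notation.  Thus + is the product of monomials, - the
   inverse and 0 the monomial 1. *)
Definition monomial : choiceType := {freeg (nat * int)%type / int}.

Definition Y (j : nat) (l : int) : monomial := << (j, l) >>.

(* A sum of monomials is the multiset of its terms, so that `+` is the sum of
   such polynomials. *)
Definition mscale (z : {mset monomial}) (w : monomial) : {mset monomial} :=
  seq_mset [seq (t + w : monomial) | t <- enum_mset z].

(* \prod_{C_p^+} Y_{f j, l} \prod_{C_p^-} Y_{f j, l}^{-1} *)
Definition corner_monomial (f : nat -> nat) (n : nat) (p : seq point) :
    monomial :=
  \sum_(c <- Cplus n p) Y (f c.1) c.2 - \sum_(c <- Cminus n p) Y (f c.1) c.2.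

Definition cong4 (a b : int) : bool := (a == b %[mod 4])%Z.

(* For p in spin_paths n k, the difference y - k is even, so that the inner
   "else" branches are the case y - k = 2 mod 4. *)
Definition spin_W (n : nat) (k : int) (p : seq point) : monomial :=
  let y := (pt p n.-1).2 in
  if (pt p n.-2).2 == y + 1 then
    if cong4 (y - k) 0 then Y n.-1 y else Y n y
  else
    if cong4 (y - k) 0 then - Y n y else - Y n.-1 y.

Definition m_spin (n : nat) (k : int) (p : seq point) : {mset monomial} :=
  [mset spin_W n k p + corner_monomial id n p].

Definition bar (n j : nat) : nat :=
  if (j <= n - 2)%N then j else (2 * n - 2 - j)%N.

(* For p in vec_paths n i k: l2 - l1 is even, so an "else" after a congruence
   test is the other even residue; y_{n-2} = l2 +- 1 and y_n = l1 +- 1.  The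
   list indices of y_{n-2}, y_{n-1}, y'_{n-1}, y_n are n-2, n-1, n, n+1. *)
Definition vec_Z (n : nat) (p : seq point) : {mset monomial} :=
  let yl := (pt p n.-2).2 in
  let l2 := (pt p n.-1).2 in
  let l1 := (pt p n).2 in
  let yr := (pt p n.+1).2 in
  if l1 < l2 then
    match yl == l2 + 1, yr == l1 + 1 with
    | false, true =>
        if cong4 (l2 - l1) 2
        then [mset Y n.-1 l1 - Y n l2] `+` [mset Y n l1 - Y n.-1 l2]
        else [mset Y n.-1 l1 - Y n.-1 l2] `+` [mset Y n l1 - Y n l2]
    | false, false =>
        if cong4 (l2 - l1) 0
        then [mset - Y n.-1 l1 - Y n l2] `+` [mset - Y n l1 - Y n.-1 l2]
        else [mset - Y n.-1 l1 - Y n.-1 l2] `+` [mset - Y n l1 - Y n l2]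
    | true, true =>
        if cong4 (l2 - l1) 0
        then [mset Y n.-1 l1 + Y n l2] `+` [mset Y n l1 + Y n.-1 l2]
        else [mset Y n.-1 l1 + Y n.-1 l2] `+` [mset Y n l1 + Y n l2]
    | true, false =>
        if cong4 (l2 - l1) 2
        then [mset - Y n.-1 l1 + Y n l2] `+` [mset - Y n l1 + Y n.-1 l2]
        else [mset - Y n.-1 l1 + Y n.-1 l2] `+` [mset - Y n l1 + Y n l2]
    end
  else
    match yl == l2 + 1, yr == l1 + 1 with
    | true, true => [mset Y n.-1 l1 + Y n l1]
    | false, false => [mset - Y n.-1 l1 - Y n l1]
    | _, _ => [mset (0 : monomial)]
    end.

Definition m_vec (n : nat) (p : seq point) : {mset monomial} :=
  mscale (vec_Z n p) (corner_monomial (bar n) n p).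

Definition m (n i : nat) (k : int) (p : seq point) : {mset monomial} :=
  if i == n.-1 then m_spin n k p else m_vec n p.

(* [fset_set A] enumerates A when A is finite and is empty otherwise. *)
Definition calM (n i : nat) (k : int) : {mset monomial} :=
  \big[msetD/mset0]_(p <- fset_set (paths n i k)) m n i k p.

(* Main.v *)
From mathcomp Require Import boolp classical_sets cardinality.
From mathcomp Require Import all_boot all_order all_algebra.
From mathcomp Require Import finmap multiset zify ring.
Require Import Defs.

(** With multiplicities, multiplying by a monomial does not change the number
    of terms, so the monomials are counted by counting the paths once or twice.

    Put [m = n - 1]. A walk of [m] steps with a given start is the same thing
    as the set of its down steps, a subset of [m] elements ([walkP]). In the
    spin case each of the [2 ^ m] walks carries one monomial.

    In the vector case let [d] be the number of down steps of the left half and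
    [u] the number of up steps of the right half, read from the right end
    inwards. The left half arrives at height [m + i - 2 * d] and the right half
    at [m - i + 2 * u], so the two middle heights differ by
    [2 * (i - d - u)]. Hence the paths are the pairs of subsets whose
    cardinals add up to at most [i] ([vec_pathsP]). The factor at the middle
    has two terms when the middle heights differ, that is when [d + u < i], and
    one when they agree, that is when [d + u = i] ([size_m_vec_path_of]). The
    pairs with [d + u = i] number ['C(2 * m, i)] by Vandermonde's identity; the
    pairs with [d + u < i], counted by cardinals, give the double sum, which
    enters twice. *)

Set Implicit Arguments.
Unset Strict Implicit.
Unset Printing Implicit Defensive.

Import Order.TTheory GRing.Theory Num.Theory.
Local Open Scope ring_scope.
Local Open Scope mset_scope.

#[local] Arguments pt : simpl never.

(** * Cardinality of multisets *)

Lemma size_seq_mset (K : choiceType) (s : seq K) : size (seq_mset s) = size s.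
Proof. exact/perm_size/perm_eq_seq_mset. Qed.

Lemma size_msetD (K : choiceType) (A B : {mset K}) :
  size (A `+` B) = (size A + size B)%N.
Proof.
rewrite -size_cat -[RHS]size_seq_mset; congr (size (enum_mset _)).
by apply/msetP => a; rewrite msetE2 mset_seqE count_cat !count_mem_mset.
Qed.

Lemma size_mset1 (K : choiceType) (a : K) : size [mset a] = 1%N.
Proof. by rewrite enum_msetn. Qed.

Lemma size_big_msetD (I : Type) (K : choiceType) (r : seq I)
    (F : I -> {mset K}) :
  size (\big[msetD/mset0]_(i <- r) F i) = (\sum_(i <- r) size (F i))%N.
Proof.
apply: (big_morph (fun A : {mset K} => size A)); last exact: size_mset0.
exact: size_msetD.
Qed.

(** Finiteness of [A] comes with the parametrization: without it [fset_set A]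
    would be empty. Then [fset_set A] and the list of the [f t] have the same
    elements, neither with repetitions. *)
Lemma sum_fset_set_param (T : finType) (U : choiceType) (f : T -> U)
    (Q : pred T) (A : set U) (F : U -> nat) :
  injective f -> (forall u, A u <-> exists2 t, Q t & u = f t) ->
  (\sum_(u <- fset_set A) F u = \sum_(t | Q t) F (f t))%N.
Proof.
move=> inj_f AE; have defA : A = [set f t | t in [set t | Q t]]%classic.
  apply/seteqP; split=> u /=.
    by move/AE=> [t Qt ->]; exists t.
  by case=> t Qt <-; apply/AE; exists t.
have finA : finite_set A by rewrite defA; apply/finite_image/finite_finset.
have peq : perm_eq (fset_set A) [seq f t | t <- enum Q].
  apply: uniq_perm; first exact: fset_uniq.
    by rewrite map_inj_uniq // enum_uniq.
  move=> u; rewrite in_fset_set //; apply/idP/mapP.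
    rewrite classical_sets.in_setE => /AE[t Qt ->].
    by exists t; rewrite ?mem_enum.
  case=> t; rewrite mem_enum => Qt ->; rewrite classical_sets.in_setE.
  by apply/AE; exists t.
by rewrite (perm_big _ peq) big_map big_enum.
Qed.

(** * Walks as subsets *)

(** [D] is the set of down steps. The closed form, in place of a sum of steps,
    makes the final height depend on [D] through its cardinal alone. *)
Definition height (m : nat) (y : int) (D : {set 'I_m}) (r : nat) : int :=
  y + r%:Z - 2 * #|[set j in D | (j < r)%N]|%:Z.

Definition walk_of (m : nat) (h : nat -> nat) (y : int) (D : {set 'I_m}) :
    seq point :=
  mkseq (fun r => (h r, height y D r)) m.+1.

Lemma height0 m y (D : {set 'I_m}) : height y D 0 = y.
Proof.
rewrite /height (_ : [set j in D | _] = set0) ?cards0; first by ring.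
by apply/setP => j; rewrite !inE andbF.
Qed.

Lemma height_end m y (D : {set 'I_m}) : height y D m = y + m%:Z - 2 * #|D|%:Z.
Proof.
rewrite /height (_ : [set j in D | _] = D) //.
by apply/setP => j; rewrite !inE ltn_ord andbT.
Qed.

Lemma heightS m y (D : {set 'I_m}) (j : 'I_m) :
  height y D j.+1 - height y D j = if j \in D then -1 else 1.
Proof.
rewrite /height (cardsD1 j [set i in D | (i < j.+1)%N]) !inE ltnSn andbT.
rewrite (_ : _ :\ j = [set i in D | (i < j)%N]).
  by move: #|_| => c; case: ifP => _ /=; lia.
apply/setP => i; rewrite !inE ltnS (ltn_neqAle i j) -val_eqE /=.
by case: (i \in D); rewrite ?andbF.
Qed.

Lemma size_walk_of m h y (D : {set 'I_m}) : size (walk_of h y D) = m.+1.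
Proof. exact: size_mkseq. Qed.

Lemma pt_walk_of m h y (D : {set 'I_m}) r :
  (r <= m)%N -> pt (walk_of h y D) r = (h r, height y D r).
Proof. by move=> le_rm; rewrite /pt nth_mkseq. Qed.

Lemma walk_of_inj m h y : injective (@walk_of m h y).
Proof.
move=> D E eqDE; apply/setP => j.
have eqh r : (r <= m)%N -> height y D r = height y E r.
  by move=> le_rm; have := pt_walk_of h y D le_rm;
     rewrite eqDE pt_walk_of // => -[].
have := heightS y D j; rewrite !eqh ?(ltnW (ltn_ord j)) // heightS.
by do 2!case: (_ \in _).
Qed.

(** Parametrizes walks by arbitrary subsets: the start is fixed, and each of the
    [m] steps is one free binary choice. *)
Lemma walkP m k h p :
  walk m.+1 k h p <-> exists D : {set 'I_m}, p = walk_of h (m%:Z + k) D.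
Proof.
split=> [[szp hp y0 step]|[D ->]].
  pose D := [set j : 'I_m | (pt p j.+1).2 - (pt p j).2 == -1].
  have hE r : (r <= m)%N -> (pt p r).2 = height (m%:Z + k) D r.
    elim: r => [|r IHr] le_rm; first by rewrite height0 y0; lia.
    have := heightS (m%:Z + k) D (Ordinal le_rm); rewrite inE /=.
    rewrite -IHr ?(ltnW le_rm) //.
    by case: (step r ltac:(lia)) => e; rewrite e /=; lia.
  exists D; apply: (@eq_from_nth _ (0%N, 0)).
    by rewrite szp size_walk_of.
  move=> r; rewrite szp ltnS => le_rm.
  rewrite -[LHS]/(pt p r) -[RHS]/(pt _ r) pt_walk_of // -hE // -hp //.
  by case: (pt p r).
split; rewrite ?size_walk_of //.
- by move=> r; rewrite ltnS => le_rm; rewrite pt_walk_of.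
- by rewrite pt_walk_of // /= height0; lia.
- move=> r; rewrite subn1 /= => lt_rm; rewrite !pt_walk_of ?(ltnW lt_rm) //=.
  have := heightS (m%:Z + k) D (Ordinal lt_rm) => /= ->.
  by case: ifP; [right | left].
Qed.

(** * Paths for the vector nodes as pairs of subsets *)

(** The second set is complemented, so that it records the up steps of the
    right half: in this way the condition on the two middle heights becomes
    symmetric in both sets. *)
Definition vec_path_of (m i : nat) (k : int) (DU : {set 'I_m} * {set 'I_m}) :
    seq point :=
  walk_of id (m%:Z + (k - (m%:Z - i%:Z))) DU.1 ++
  rev (walk_of (fun r => (2 * m - r)%N) (m%:Z + (k + (m%:Z - i%:Z))) (~: DU.2)).

Lemma vec_path_of_inj m i k : injective (@vec_path_of m i k).
Proof.
move=> [D U] [D' U'] /eqP; rewrite eqseq_cat ?size_walk_of //=.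
case/andP=> /eqP/walk_of_inj-> /eqP/(can_inj revK)/walk_of_inj/(can_inj setCK).
by move=> ->.
Qed.

(** The final heights of the two halves are affine in [#|D|] and [#|U|] with
    opposite slopes, so that comparing them is a bound on [#|D| + #|U|]. *)
Lemma left_middle_height m i k (D : {set 'I_m}) :
  height (m%:Z + (k - (m%:Z - i%:Z))) D m = m%:Z + k + i%:Z - 2 * #|D|%:Z.
Proof. by rewrite height_end; ring. Qed.

Lemma right_middle_height m i k (U : {set 'I_m}) :
  height (m%:Z + (k + (m%:Z - i%:Z))) (~: U) m
    = m%:Z + k - i%:Z + 2 * #|U|%:Z.
Proof.
rewrite height_end; have := cardsC U; rewrite card_ord.
by move: #|U| #|~: U| => u c; lia.
Qed.

Lemma pt_vec_path_left m i k (DU : {set 'I_m} * {set 'I_m}) :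
  (pt (vec_path_of i k DU) m).2 = m%:Z + k + i%:Z - 2 * #|DU.1|%:Z.
Proof.
rewrite /pt /vec_path_of nth_cat size_walk_of ltnSn -/(pt _ _).
by rewrite pt_walk_of // left_middle_height.
Qed.

Lemma pt_vec_path_right m i k (DU : {set 'I_m} * {set 'I_m}) :
  (pt (vec_path_of i k DU) m.+1).2 = m%:Z + k - i%:Z + 2 * #|DU.2|%:Z.
Proof.
rewrite /pt /vec_path_of nth_cat size_walk_of ltnn subnn.
rewrite nth_rev size_walk_of // subn1.
by rewrite -/(pt _ _) pt_walk_of // right_middle_height.
Qed.

(** The order of the two middle heights is the only link between the halves, and
    by the formulas above it bounds the total of the two cardinals by [i]. *)
Lemma vec_pathsP m i k p :
  vec_paths m.+1 i k p <->
  exists2 DU : {set 'I_m} * {set 'I_m},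
    (#|DU.1| + #|DU.2| <= i)%N & p = vec_path_of i k DU.
Proof.
have mi : m.+1%:Z - i%:Z - 1 = m%:Z - i%:Z by lia.
have hatE : (fun r => (2 * m.+1 - 2 - r)%N) = (fun r => (2 * m - r)%N).
  by apply/funext => r; lia.
rewrite /vec_paths /spin_paths_hat /spin_paths /= mi hatE; split.
  case=> a [b [/walkP[D ->] /walkP[E ->] _ le_ba ->]].
  exists (D, ~: E); last by rewrite /vec_path_of /= setCK.
  move: le_ba; rewrite !pt_walk_of //= left_middle_height.
  rewrite -[X in height _ X m]setCK right_middle_height.
  by move: #|D| #|~: E| => d u; lia.
case=> -[D U] /= le_DU_i ->.
exists (walk_of id (m%:Z + (k - (m%:Z - i%:Z))) D).
exists (walk_of (fun r => (2 * m - r)%N) (m%:Z + (k + (m%:Z - i%:Z))) (~: U)).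
split=> //; [by apply/walkP; exists D | by apply/walkP; exists (~: U) | |].
  by rewrite !pt_walk_of //=; lia.
rewrite !pt_walk_of //= left_middle_height right_middle_height.
by move: #|D| #|U| le_DU_i => d u; lia.
Qed.

(** * Number of monomials of a path *)

(** All four corner configurations at the middle give a binomial when the two
    heights differ and a single monomial when they agree, so the number of
    terms depends on these heights only. *)
Lemma size_m_vec n p :
  size (m_vec n p) = ((pt p n).2 < (pt p n.-1).2)%R.+1.
Proof.
rewrite /m_vec /mscale size_seq_mset size_map /vec_Z.
by do ?case: ifP => _ /=; rewrite ?size_msetD ?size_mset1.
Qed.

Lemma size_m_vec_path_of m i k (DU : {set 'I_m} * {set 'I_m}) :
  size (m_vec m.+1 (vec_path_of i k DU)) = (#|DU.1| + #|DU.2| < i)%N.+1.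
Proof.
rewrite size_m_vec pt_vec_path_left pt_vec_path_right; congr (nat_of_bool _).+1.
by apply/idP/idP; lia.
Qed.

(** * Counting pairs of subsets *)

(** Groups the subsets of [T] by cardinal. The cut at [M] may lie on either side
    of [#|T|], since the binomial coefficients vanish beyond it. *)
Lemma sum_card_lt (T : finType) (M : nat) (F : nat -> nat) :
  (\sum_(A : {set T} | (#|A| < M)%N) F #|A|
     = \sum_(0 <= j < M) 'C(#|T|, j) * F j)%N.
Proof.
rewrite big_mkord
  (eq_bigr (fun j : 'I_M => \sum_(A : {set T} | #|A| == j) F #|A|)%N).
  rewrite (exchange_big_dep (fun A : {set T} => #|A| < M)%N) /=; last first.
    by move=> j A _ /eqP->.
  apply: eq_bigr => A ltAM; rewrite (big_pred1 (Ordinal ltAM)) //.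
move=> j _; rewrite (eq_bigr (fun=> F j)); last by move=> A /eqP->.
by rewrite sum_nat_const -card_draws cardsE.
Qed.

Lemma card_set_pairs_lt (T : finType) (i : nat) :
  (\sum_(DU : {set T} * {set T} | (#|DU.1| + #|DU.2| < i)%N) 1
     = \sum_(0 <= j < i.+1) \sum_(0 <= l < i - j) 'C(#|T|, j) * 'C(#|T|, l))%N.
Proof.
have numE M :
    (\sum_(B : {set T} | #|B| < M) 1 = \sum_(0 <= l < M) 'C(#|T|, l))%N.
  by rewrite (sum_card_lt T M (fun=> 1%N)); under eq_bigr do rewrite muln1.
under [RHS]eq_bigr do rewrite -big_distrr /= -numE.
rewrite -(sum_card_lt T i.+1
  (fun j => \sum_(B : {set T} | (#|B| < i - j)%N) 1))%N pair_big_dep /=.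
by apply: eq_bigl => -[D U] /=; lia.
Qed.

(** Vandermonde convolution; bijectively, a pair of subsets of [T] is a subset
    of the disjoint union of two copies of [T]. *)
Lemma card_set_pairs_eq (T : finType) (i : nat) :
  (\sum_(DU : {set T} * {set T} | #|DU.1| + #|DU.2| == i) 1
     = 'C(2 * #|T|, i))%N.
Proof.
rewrite mul2n -addnn -binomial.Vandermonde -(big_mkord xpredT
  (fun j => 'C(#|T|, j) * 'C(#|T|, i - j)))%N.
rewrite -(sum_card_lt T i.+1 (fun j => 'C(#|T|, i - j))).
under [RHS]eq_bigr => A _.
  rewrite -card_draws cardsE -sum1_card; over.
rewrite pair_big_dep /=.
by apply: eq_bigl => -[D U] /=; rewrite unfold_in; lia.
Qed.

(** * The two counts *)

(** Counting each path once or twice is splitting the pairs of subsets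
    according to whether their total cardinal attains [i]. *)
Lemma size_calM_vec (m i : nat) : (i < m)%N ->
  size (calM m.+1 i 0) =
    ('C(2 * m, i) +
     2 * \sum_(0 <= j < i.+1) \sum_(0 <= l < i - j) 'C(m, j) * 'C(m, l))%N.
Proof.
move=> lt_im; rewrite /calM size_big_msetD /paths /Defs.m (ltn_eqF lt_im).
rewrite (sum_fset_set_param _ (@vec_path_of_inj m i 0) (@vec_pathsP m i 0)).
under eq_bigr do rewrite size_m_vec_path_of.
have := card_set_pairs_lt 'I_m i; have := card_set_pairs_eq 'I_m i.
rewrite card_ord => <- <-.
rewrite (bigID
  (fun DU : {set 'I_m} * {set 'I_m} => #|DU.1| + #|DU.2| == i)%N) /=.
congr addn.
  apply: eq_big => [DU|DU /andP[_ /eqP->]]; last by rewrite ltnn.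
  by rewrite andb_idl // => /eqP->.
rewrite big_distrr /=; apply: eq_big => [DU|DU].
  by rewrite [RHS]ltn_neqAle andbC.
by rewrite andbC -ltn_neqAle => ->.
Qed.

Lemma size_calM_spin (m : nat) : size (calM m.+1 m 0) = (2 ^ m)%N.
Proof.
rewrite /calM size_big_msetD /paths /Defs.m eqxx.
rewrite (@sum_fset_set_param {set 'I_m} _ (walk_of id (m%:Z + 0)) xpredT).
- under eq_bigr do rewrite /m_spin size_mset1.
  by rewrite sum1_card -cardsT -powersetT card_powerset cardsT card_ord.
- exact: walk_of_inj.
- move=> p; split=> [/walkP[D ->]|[D _ ->]]; first by exists D.
  by apply/walkP; exists D.
Qed.

Theorem theorem4p2 (n : nat) (hn : (4 <= n)%N) :
  (forall i : nat, (1 <= i < n - 1)%N ->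
     size (calM n i 0) =
       ('C(2 * n - 2, i) +
        2 * \sum_(0 <= j < i.+1) \sum_(0 <= l < i - j)
              'C(n - 1, j) * 'C(n - 1, l))%N) /\
  size (calM n (n - 1) 0) = (2 ^ (n - 1))%N.
Proof.
case: n hn => // m _; rewrite subn1 /=.
rewrite (_ : 2 * m.+1 - 2 = 2 * m)%N; last by lia.
split=> [i /andP[_ lt_im]|]; first exact: size_calM_vec.
exact: size_calM_spin.
Qed.
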